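(* Let $X$ be a compact metrizable space and let $\Delta$ be a closed set of Borel probability measures on $X$. The C*-algebra $\ell^\infty(\mathrm{C}(X))/J_{2,\omega,\Delta}$ has real rank zero if, and only if, $(X,\Delta)$ has the small boundary property.
   Context: ''Closed'' refers to the weak* topology; measures $\mu$ act as traces $\tau_\mu(f)=\int f\,d\mu$. $\omega$ is a free ultrafilter on $\mathbb N$ and $J_{2,\omega,\Delta}=\{(f_n)\in\ell^\infty(\mathrm{C}(X)):\lim_{n\to\omega}\sup_{\tau\in\Delta}\tau(|f_n|^2)=0\}$. A unital C*-algebra has real rank zero if its invertible self-adjoint elements are norm-dense in its self-adjoint elements. $(X,\Delta)$ has the small boundary property if for every $x\in X$ and every open $U\ni x$ there is an open neighbourhood $V\subseteq U$ of $x$ with $\mu(\partial V)=0$ for all $\mu\in\Delta$. *)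

(* Defs.v *)
From HB Require Import structures.
From mathcomp Require Import all_boot all_order all_algebra.
From mathcomp Require Import all_classical all_reals all_analysis.
From mathcomp Require Import complex.
Set Implicit Arguments. Unset Strict Implicit. Unset Printing Implicit Defensive.
Import Order.TTheory GRing.Theory Num.Theory.
Import numFieldNormedType.Exports.
Local Open Scope classical_set_scope.
Local Open Scope ring_scope.

Notation borelX X := (g_sigma_algebraType (@open X)).

Definition free_ultrafilter (w : set (set nat)) : Prop :=
  ~ w set0 /\
  w setT /\
  (forall A B, w A -> w B -> w (setI A B)) /\
  (forall A B : set nat, A `<=` B -> w A -> w B) /\
  (forall A, w A \/ w (~` A)) /\
  (forall A : set nat, finite_set A -> ~ w A).

Section Defs.
Context {R : realType} {X : pseudoPMetricType R}.
Local Notation C := R[i].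
Local Notation BX := (borelX X).

Definition weakstar_closed (Delta : set (probability BX R)) : Prop :=
  forall mu : probability BX R, ~ Delta mu ->
    exists (k : nat) (f : 'I_k -> X -> R) (e : R),
      0 < e /\ (forall i, continuous (f i)) /\
      forall nu : probability BX R,
        (forall i, `| (\int[nu]_x (f i x)%:E) - (\int[mu]_x (f i x)%:E) |%E
                     < e%:E)%E ->
        ~ Delta nu.

Definition ccontinuous (f : X -> C) : Prop :=
  continuous (fun x => complex.Re (f x)) /\ continuous (fun x => complex.Im (f x)).

Definition linf (a : nat -> X -> C) : Prop :=
  (forall n, ccontinuous (a n)) /\
  exists M : R, forall n x, ComplexField.Normc.normc (a n x) <= M.

Definition J2 (w : set (set nat)) (Delta : set (probability BX R))
    (a : nat -> X -> C) : Prop :=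
  linf a /\
  forall e : R, 0 < e ->
    w [set n | (ereal_sup
                 [set \int[mu]_x ((ComplexField.Normc.normc (a n x)) ^+ 2)%:E
                 | mu in Delta] < e%:E)%E].

Definition seq_conj (a : nat -> X -> C) : nat -> X -> C :=
  fun n x => conjc (a n x).
Definition seq_sub (a b : nat -> X -> C) : nat -> X -> C :=
  fun n x => a n x - b n x.
Definition seq_mul (a b : nat -> X -> C) : nat -> X -> C :=
  fun n x => a n x * b n x.
Definition seq_one : nat -> X -> C := fun _ _ => 1.

(* Elements of the quotient ell^infty(C(X))/J are cosets [a], a in linf. *)
Definition quot_selfadjoint w Delta (a : nat -> X -> C) : Prop :=
  linf a /\ J2 w Delta (seq_sub (seq_conj a) a).

Definition quot_invertible w Delta (b : nat -> X -> C) : Prop :=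
  linf b /\ exists c, linf c /\
    J2 w Delta (seq_sub (seq_mul b c) seq_one) /\
    J2 w Delta (seq_sub (seq_mul c b) seq_one).

(* quotient norm ||[a] - [b]|| = inf_{j in J} sup_n ||a_n - b_n - j_n||_oo < e *)
Definition quot_dist_lt w Delta (a b : nat -> X -> C) (e : R) : Prop :=
  exists j, J2 w Delta j /\ exists d : R, d < e /\
    forall n x, ComplexField.Normc.normc (a n x - b n x - j n x) <= d.

Definition quot_real_rank_zero w Delta : Prop :=
  forall a, quot_selfadjoint w Delta a ->
  forall e : R, 0 < e ->
    exists b, quot_selfadjoint w Delta b /\ quot_invertible w Delta b /\
              quot_dist_lt w Delta a b e.

Definition small_boundary_property (Delta : set (probability BX R)) : Prop :=
  forall (x : X) (U : set X), open U -> U x ->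
    exists V : set X, open V /\ V x /\ V `<=` U /\
      forall mu : probability BX R, Delta mu ->
        mu ((closure V `\` interior V) : set BX) = 0%E.

End Defs.

(* Main.v *)
(* If V is an open set with Delta-null boundary, sandwiched between {f <= -e} and
   {f < e}, then moving f by 2e downwards on V and upwards off V makes it at least e
   in absolute value outside a thin neighbourhood of the boundary of V.  By Dini's
   theorem on the weak* compact set Delta this neighbourhood can be chosen of
   uniformly small measure, so the perturbed f is invertible in the quotient.
   Compactness is needed only for a sequence in Delta: its limit along the
   ultrafilter is a finitely additive content on closed sets, from which a Borel
   probability is recovered by Caratheodory's construction.

   Conversely, real rank zero lets one perturb any f slightly so that
   mu {|g| <= h} is uniformly small on Delta for some h > 0.  Iterating with
   summable perturbations, the sets {f_k < -h_k} increase to an open set whose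
   boundary lies in every {|f_k| <= h_k}, hence is Delta-null. *)
Require Import Defs.
From HB Require Import structures.
From mathcomp Require Import all_boot all_order all_algebra.
From mathcomp Require Import all_classical all_reals all_analysis.
From mathcomp Require Import complex.
From mathcomp Require Import measurable_realfun lra.
Set Implicit Arguments. Unset Strict Implicit. Unset Printing Implicit Defensive.
Import Order.TTheory GRing.Theory Num.Theory.
Import numFieldNormedType.Exports.
Local Open Scope classical_set_scope.
Local Open Scope ring_scope.

(** * Closed sets as zero sets of continuous functions *)

Section ClosedZeroSets.
Context {R : realType} {X : pseudoPMetricType R}.
Implicit Types A K U V : set X.

(** [phi] is the distance to [A] truncated at 1. The truncation keeps it finite, also when [A] is
    empty and the distance is infinite. *)
Lemma closed_zero_set A : closed A ->
  exists phi : X -> R, [/\ continuous phi, forall x, 0 <= phi x &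
    forall x, phi x = 0 <-> A x].
Proof.
move=> cA; pose phi x : R := fine (mine 1%:E (edist_inf A x)).
have fin x : mine 1%:E (edist_inf A x) \is a fin_num.
  rewrite ge0_fin_numE ?le_min ?edist_inf_ge0 ?lee_fin ?ler01//.
  by rewrite gt_min ltry.
exists phi; split.
- move=> x; rewrite /continuous_at /phi.
  apply: fine_cvg; rewrite fineK//.
  have := @min_fun_continuous _ X (\bar R) (cst 1%:E) (edist_inf A).
  by apply; [exact: cst_continuous|exact: edist_inf_continuous].
- move=> x; rewrite /phi fine_ge0// le_min edist_inf_ge0 lee_fin ler01//.
- move=> x; rewrite /phi; split => [p0|Ax]; last first.
    by rewrite edist_inf0// min_r ?lee_fin.
  have m0 : mine 1%:E (edist_inf A x) = 0%E by rewrite -(fineK (fin x)) p0.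
  have d0 : edist_inf A x = 0%E.
    move: m0; case: leP => // _ /eqP; rewrite eqe => /eqP e10.
    by have := @oner_neq0 R; rewrite e10 eqxx.
  apply: cA => B /nbhs_ballP[e /= e0 xeB].
  have : (edist_inf A x < e%:E)%E by rewrite d0 lte_fin.
  move=> /ereal_inf_lt[_ [a Aa <-] dae]; exists a; split => //.
  exact: (xeB _ (edist_lt_ball dae)).
Qed.

End ClosedZeroSets.

(** * Carathéodory extension of a content on closed sets *)

Section ContentExtension.
Context {R : realType} {X : pseudoPMetricType R}.
Local Notation BX := (borelX X).
Implicit Types A K U V : set X.
Hypothesis cX : compact [set: X].
Variable L : set X -> R.
Hypothesis L0 : L set0 = 0.
Hypothesis LT : L setT = 1.
Hypothesis L_mono : forall K1 K2, closed K1 -> closed K2 ->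
  K1 `<=` K2 -> L K1 <= L K2.
Hypothesis L_subadd : forall K1 K2, closed K1 -> closed K2 ->
  L (K1 `|` K2) <= L K1 + L K2.
Hypothesis L_superadd : forall K1 K2, closed K1 -> closed K2 ->
  K1 `&` K2 = set0 -> L K1 + L K2 <= L (K1 `|` K2).

(** Two-step regularisation, as in the Riesz-Markov construction: from inside by closed sets on open
    sets, then from outside by open sets on arbitrary sets. *)
Let inner U : \bar R := ereal_sup [set (L K)%:E | K in [set K | closed K /\ K `<=` U]].
Let outer A : \bar R := ereal_inf [set inner U | U in [set U | open U /\ A `<=` U]].

Let le_inner K U : closed K -> K `<=` U -> ((L K)%:E <= inner U)%E.
Proof. by move=> cK KU; apply: ereal_sup_ubound; exists K. Qed.

Let inner_ge0 U : (0 <= inner U)%E.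
Proof. by have := le_inner closed0 (@sub0set _ U); rewrite L0. Qed.

Let inner_le1 U : (inner U <= 1%:E)%E.
Proof.
apply: ge_ereal_sup => _ [K [cK _] <-]; rewrite lee_fin -LT.
by apply: L_mono => //; exact: closedT.
Qed.

Let inner_mono U V : U `<=` V -> (inner U <= inner V)%E.
Proof.
move=> UV; apply: ereal_sup_le => _ [K [cK KU] <-]; exists K => //.
by split => //; exact: subset_trans UV.
Qed.

Let inner_fin U : inner U \is a fin_num.
Proof. by rewrite ge0_fin_numE// (le_lt_trans (inner_le1 U)) ?ltry. Qed.

(* A compact [K] inside [U `|` V] splits along [{phi <= psi}], where [phi] and
   [psi] vanish exactly off [U] and off [V]. *)
Let innerU U V : open U -> open V -> (inner (U `|` V) <= inner U + inner V)%E.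
Proof.
move=> oU oV; apply: ge_ereal_sup => _ [K [cK KUV] <-].
have [phi [cphi phi0 phiU]] := closed_zero_set (open_closedC oU).
have [psi [cpsi psi0 psiV]] := closed_zero_set (open_closedC oV).
have cd : continuous (phi \- psi).
  by move=> x; apply: continuousB; [exact: cphi|exact: cpsi].
pose K1 := K `&` (phi \- psi) @^-1` [set r | 0 <= r].
pose K2 := K `&` (phi \- psi) @^-1` [set r | r <= 0].
have cK1 : closed K1.
  by apply: closedI => //; apply: preimage_closed => [x _|]; [exact: cd|exact: closed_ge].
have cK2 : closed K2.
  by apply: closedI => //; apply: preimage_closed => [x _|]; [exact: cd|exact: closed_le].
have -> : K = K1 `|` K2.
  apply/seteqP; split => [x Kx|x [[]|[]]//].
  by have [h|h] := leP 0 ((phi \- psi) x); [left|right]; split => //; exact: ltW.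
apply: (@le_trans _ _ ((L K1)%:E + (L K2)%:E)%E).
  by rewrite -EFinD lee_fin; exact: L_subadd.
apply: leeD; apply: le_inner => // x [Kx /=].
- rewrite subr_ge0 => psiphi; apply: contrapT => nUx.
  have phix0 : phi x = 0 by apply/phiU.
  have psix0 : psi x = 0 by apply/eqP; rewrite eq_le psi0 andbT -phix0.
  by have [//|] := KUV _ Kx; apply/psiV.
- rewrite subr_le0 => phipsi; apply: contrapT => nVx.
  have psix0 : psi x = 0 by apply/psiV.
  have phix0 : phi x = 0 by apply/eqP; rewrite eq_le phi0 andbT -psix0.
  by have [|//] := KUV _ Kx; apply/phiU.
Qed.

Let inner_bigsetU (F : (set X)^nat) n : (forall i, open (F i)) ->
  (inner (\big[setU/set0]_(i < n) F i) <= \sum_(i < n) inner (F i))%E.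
Proof.
move=> oF; elim: n => [|n ih].
  rewrite !big_ord0; apply: ge_ereal_sup => _ [K [cK K0] <-].
  by move: K0; rewrite subset0 => ->; rewrite L0.
rewrite !big_ord_recr/=; apply: (le_trans (innerU _ (oF n))).
  by rewrite -bigcup_mkord; apply: bigcup_open => i _; exact: oF.
by rewrite leeD2r.
Qed.

(** A closed [K] inside the union is compact, so finitely many of the [F i] cover it and finite
    subadditivity suffices. *)
Let inner_bigcup (F : (set X)^nat) : (forall i, open (F i)) ->
  (inner (\bigcup_n F n) <= \sum_(0 <= i <oo) inner (F i))%E.
Proof.
move=> oF; apply: ge_ereal_sup => _ [K [cK KF] <-].
have : cover_compact K.
  by rewrite -compact_cover; exact: (subclosed_compact cK cX).
move=> /(_ nat setT F (fun i _ => oF i) KF)[D _ KD].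
pose n := (\max_(i <- finmap.enum_fset D) i).+1.
apply: (@le_trans _ _ (\sum_(i < n) inner (F i))%E); last first.
  rewrite -(big_mkord xpredT (fun i => inner (F i))).
  exact: nneseries_lim_ge.
apply: (le_trans _ (inner_bigsetU n oF)); apply: le_inner => //.
move=> x /KD[i /= iD Fix]; rewrite -bigcup_mkord; exists i => //=.
by rewrite /n ltnS; exact: leq_bigmax_seq.
Qed.

Let outer_open U : open U -> outer U = inner U.
Proof.
move=> oU; apply/eqP; rewrite eq_le; apply/andP; split.
  by apply: ereal_inf_lbound; exists U => //; split.
by apply: le_ereal_inf_tmp => _ [V [oV UV] <-]; exact: inner_mono.
Qed.

Let outer_ge0 A : (0 <= outer A)%E.
Proof. by apply: le_ereal_inf_tmp => _ [U _ <-]. Qed.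

Let outer_mono : {homo outer : A B / A `<=` B >-> (A <= B)%E}.
Proof.
move=> A B AB; apply: ereal_inf_le_tmp => _ [U [oU BU] <-]; exists U => //.
by split => //; exact: subset_trans BU.
Qed.

Let outer_fin A : outer A \is a fin_num.
Proof.
rewrite ge0_fin_numE// (@le_lt_trans _ _ (inner setT))//.
  by apply: ereal_inf_lbound; exists setT => //; split => //; exact: openT.
by rewrite -ge0_fin_numE.
Qed.

Let outer0 : outer set0 = 0%E.
Proof.
rewrite outer_open; last exact: open0.
apply/eqP; rewrite eq_le inner_ge0 andbT; apply: ge_ereal_sup => _ [K [cK K0] <-].
by move: K0; rewrite subset0 => ->; rewrite L0.
Qed.

Let outer_approx A (e : R) : 0 < e ->
  exists U, [/\ open U, A `<=` U & (inner U <= outer A + e%:E)%E].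
Proof.
move=> e0; have [_ [U [oU AU] <-] /ltW] := lb_ereal_inf_adherent e0 (outer_fin A).
by exists U.
Qed.

(** Each [A n] is enclosed in an open [U n] with error [e / 2 ^ n.+1]; the errors sum to [e]. *)
Let outer_sigma_subadditive : sigma_subadditive outer.
Proof.
move=> A; apply/lee_addgt0Pr => e e0.
apply: (le_trans _ (epsilon_trick xpredT (fun n => outer_ge0 (A n)) (ltW e0))).
have he n : 0 < e / (2 ^ n.+1)%:R by rewrite divr_gt0// ltr0n expn_gt0.
have [U HU] := choice (fun n => outer_approx (A n) (he n)).
apply: (@le_trans _ _ (inner (\bigcup_n U n))).
  apply: ereal_inf_lbound; exists (\bigcup_n U n) => //; split.
    by apply: bigcup_open => n _; have [] := HU n.
  by move=> x [n _ Anx]; exists n => //; have [_ + _] := HU n; exact.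
apply: le_trans; first by apply: inner_bigcup => n; have [] := HU n.
by apply: lee_nneseries => // n _; have [_ _] := HU n.
Qed.

Let mu : {outer_measure set X -> \bar R} :=
  HB.pack outer (isOuterMeasure.Build R X outer outer0 outer_ge0 outer_mono
    outer_sigma_subadditive).

(** Enclose [A] in an open [W], let a closed [K1] nearly exhaust [W] inside [U], and then a closed
    [K2] nearly exhaust the open set that [K1] leaves of [W], which contains [A] minus [U]. As [K1]
    and [K2] are disjoint, superadditivity applies; the three approximations cost [e / 3] each. *)
Let open_caratheodory U : open U -> mu.-caratheodory U.
Proof.
move=> oU; apply: le_caratheodory_measurable => A; rewrite /mu/=.
apply/lee_addgt0Pr => e e0.
have e30 : 0 < e / 3 by rewrite divr_gt0.
have [W [oW AW Wle]] := outer_approx A e30.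
have [_ [K1 [cK1 K1WU] <-] /ltW] := ub_ereal_sup_adherent e30 (inner_fin (W `&` U)).
rewrite -/(inner _) => hK1.
have [_ [K2 [cK2 K2WK1] <-] /ltW] := ub_ereal_sup_adherent e30 (inner_fin (W `\` K1)).
rewrite -/(inner _) => hK2.
have h1 : (outer (A `&` U) <= inner (W `&` U))%E.
  apply: ereal_inf_lbound; exists (W `&` U) => //; split; first exact: openI.
  by apply: setSI.
have h2 : (outer (A `&` ~` U) <= inner (W `\` K1))%E.
  apply: ereal_inf_lbound; exists (W `\` K1) => //; split.
    by rewrite setDE; apply: openI => //; exact: closed_openC.
  by move=> x [Ax nUx]; split; [exact: AW|move=> /K1WU[]].
have h3 : ((L K1 + L K2)%:E <= inner W)%E.
  apply: (@le_trans _ _ (L (K1 `|` K2))%:E).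
    rewrite lee_fin; apply: L_superadd => //; apply/seteqP; split => // x [xK1].
    by move=> /K2WK1[_].
  apply: le_inner; first exact: closedU.
  by move=> x [/K1WU[]|/K2WK1[]].
move: h1 h2 h3 hK1 hK2 Wle.
rewrite -(fineK (outer_fin (A `&` U))) -(fineK (outer_fin (A `&` ~` U))).
rewrite -(fineK (outer_fin A)) -(fineK (inner_fin W)).
rewrite -(fineK (inner_fin (W `&` U))) -(fineK (inner_fin (W `\` K1))).
rewrite -!EFinD !lee_fin; lra.
Qed.

Let borel_caratheodory (A : set BX) : measurable A -> mu.-caratheodory A.
Proof.
apply: smallest_sub => [|U oU]; last exact: open_caratheodory.
split => //.
- exact: caratheodory_measurable_set0.
- by move=> B mB; rewrite setTD; exact: caratheodory_measurable_setC.
- by move=> F mF; exact: caratheodory_measurable_bigcup.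
Qed.

Let muB : set BX -> \bar R := outer.

Let muB_sigma_additive : semi_sigma_additive muB.
Proof.
move=> F mF tF mUF; apply: (@caratheodory_measure_sigma_additive _ _ mu) => //.
- by move=> i; exact: borel_caratheodory.
- exact: borel_caratheodory.
Qed.

Let muBT : muB setT = 1%E.
Proof.
rewrite /muB outer_open; last exact: openT.
apply/eqP; rewrite eq_le inner_le1/= -LT.
by apply: le_inner => //; exact: closedT.
Qed.

(** Only an inequality can hold on closed sets: if [L] is the limit of the point masses at 1/n, then
    [L] vanishes on {0} while [P] is the point mass at 0. *)
Lemma content_extension : exists P : probability BX R,
  forall K, closed K -> ((L K)%:E <= P K)%E.
Proof.
pose m : measure BX R := HB.pack muB
  (isMeasure.Build _ _ _ muB outer0 outer_ge0 muB_sigma_additive).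
pose P : probability BX R := HB.pack (Measure.sort m)
  (Measure_isProbability.Build _ _ _ m muBT).
exists P => K cK; apply: le_ereal_inf_tmp => _ [U [oU KU] <-].
exact: le_inner.
Qed.

End ContentExtension.

(** * Integrals of continuous functions against Borel probabilities *)

Section ContinuousIntegrals.
Context {R : realType} {X : pseudoPMetricType R}.
Local Notation BX := (borelX X).
Implicit Types (P Q : probability BX R) (K U V : set X) (f g : X -> R).

Lemma open_borel U : open U -> measurable (U : set BX).
Proof. by move=> oU; exact: sub_sigma_algebra. Qed.

Lemma closed_borel K : closed K -> measurable (K : set BX).
Proof.
move=> cK; have := measurableC (open_borel (closed_openC cK)).
by rewrite setCK.
Qed.

Lemma continuous_borel f : continuous f -> measurable_fun setT (f : BX -> R).
Proof.
move=> cf; apply: (measurability _ (@RGenOpens.measurableE R)).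
move=> _ [_ [a [b ->] <-]]; rewrite setTI; apply: open_borel.
by apply: open_comp => [x _|]; [exact: cf|exact: interval_open].
Qed.

Lemma integrable_bounded P f M : measurable_fun setT (f : BX -> R) ->
  (forall x, `|f x| <= M) -> P.-integrable setT (EFin \o (f : BX -> R)).
Proof.
move=> mf fM; apply: measurable_bounded_integrable => //.
  by apply: (@le_lt_trans _ _ 1%E); [exact: probability_le1|exact: ltry].
by exists M; split; [exact: num_real|move=> y My x _; exact: (le_trans (fM x) (ltW My))].
Qed.

Lemma fin_num_probability P (A : set BX) : measurable A -> P A \is a fin_num.
Proof.
move=> mA; rewrite ge0_fin_numE//.
by rewrite (le_lt_trans (probability_le1 P mA)) ?ltry.
Qed.

Lemma fine_probability_le P (A B : set BX) : measurable A -> measurable B ->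
  A `<=` B -> fine (P A) <= fine (P B).
Proof.
move=> mA mB AB; rewrite fine_le ?fin_num_probability//.
by rewrite le_measure// inE.
Qed.

(** The sum counts the integers from 1 to [k] that are at most [t], so it is the minimum of [k] and
    the integer part of [t]; the disjunction says which of the two is attained. *)
Lemma sum_threshold_bounds (t : R) (k : nat) : 0 <= t ->
  let S := \sum_(i < k) (i.+1%:R <= t)%R%:R : R in
  [/\ S <= t, S <= k%:R & k%:R <= S \/ t <= S + 1].
Proof.
move=> t0 /=; elim: k => [|k [St Sk ih]]; first by rewrite big_ord0; split=> //; left.
rewrite big_ord_recr/= -natr1; have [kt|tk] /= := leP (k%:R + 1) t.
  split; [|by rewrite lerD2r|].
    by apply: le_trans kt; rewrite lerD2r.
  by case: ih => ih; [left; rewrite lerD2r|right; rewrite (le_trans ih)// ler_wpDr].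
rewrite addr0; split => //; first by rewrite ler_wpDr.
by case: ih => ih; right => //; apply: (le_trans (ltW tk)); rewrite lerD2r.
Qed.

Lemma indic_integrable P (A : set BX) : measurable A ->
  P.-integrable setT (EFin \o (\1_A : BX -> R)).
Proof.
move=> mA; apply: (@integrable_bounded _ _ 1); first exact: measurable_indic.
by move=> x; rewrite indicE; case: (_ \in _); rewrite ?normr1 ?normr0.
Qed.

Lemma Rintegral_probability_cst P (r : R) : \int[P]_x (cst r x) = r.
Proof.
rewrite Rintegral_cst//; have /= -> := @probability_setT _ _ _ P.
by rewrite mulr1.
Qed.

Lemma sum_indic_integrable P (F : nat -> set BX) n :
  (forall i, measurable (F i)) ->
  P.-integrable setT (EFin \o (fun x : BX => \sum_(i < n) \1_(F i) x)) /\
  \int[P]_x (\sum_(i < n) \1_(F i) x) = \sum_(i < n) fine (P (F i)).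
Proof.
move=> mF; elim: n => [|n [ih1 ih2]].
  split.
    under eq_fun do rewrite big_ord0.
    by apply: (@integrable_bounded _ _ 0) => // x; rewrite normr0.
  under eq_Rintegral do rewrite big_ord0.
  by rewrite big_ord0 Rintegral_cst// mul0r.
have e1 : (fun x : BX => \sum_(i < n.+1) \1_(F i) x) =
    (fun x => \sum_(i < n) \1_(F i) x + \1_(F n) x : R).
  by apply/funext => x; rewrite big_ord_recr.
have In := indic_integrable P (mF n).
rewrite e1; split.
  by have := integrableD measurableT ih1 In; apply: eq_integrable.
rewrite RintegralD// ih2 big_ord_recr/=; congr (_ + _).
by rewrite /Rintegral integral_indic// setIT.
Qed.

(** A discrete layer-cake formula: replacing [m * g] by its integer part costs at most 1/m after
    division. It expresses integrals through measures of closed superlevel sets, the only sets that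
    the ultralimit controls. *)
Lemma Rintegral_layers P g (m : nat) : (0 < m)%N -> continuous g ->
    (forall x, 0 <= g x <= 1) ->
  let S := m%:R^-1 * \sum_(i < m) fine (P [set x | i.+1%:R <= m%:R * g x]) in
  (S <= \int[P]_x g x <= S + m%:R^-1) : Prop.
Proof.
move=> m0 cg g01 S.
have m0R : 0 < m%:R :> R by rewrite ltr0n.
pose F i : set BX := [set x | i.+1%:R <= m%:R * g x].
have mF i : measurable (F i).
  apply: closed_borel.
  apply: (@preimage_closed _ _ (fun x => m%:R * g x) [set r | i.+1%:R <= r]).
    by move=> x _; apply: cvgM; [exact: cvg_cst|exact: cg].
  exact: closed_ge.
have [iS eS] := sum_indic_integrable P m mF.
have SE (x : BX) : \sum_(i < m) \1_(F i) x =
    \sum_(i < m) (i.+1%:R <= m%:R * g x)%R%:R :> R.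
  apply: eq_bigr => i _; rewrite indicE /F; congr (nat_of_bool _)%:R.
  by apply/idP/idP; rewrite inE.
have ig : P.-integrable setT (EFin \o (g : BX -> R)).
  apply: (@integrable_bounded _ _ 1); first exact: continuous_borel.
  by move=> x; have /andP[g0 g1] := g01 x; rewrite ger0_norm.
have -> : S = \int[P]_x (m%:R^-1 * \sum_(i < m) \1_(F i) x).
  by rewrite RintegralZl// eS.
have iZ : P.-integrable setT (EFin \o (fun x : BX => m%:R^-1 * \sum_(i < m) \1_(F i) x)).
  by have := @integrableZl _ _ _ _ _ measurableT m%:R^-1 _ iS; apply: eq_integrable.
have i1 : P.-integrable setT (EFin \o (cst m%:R^-1 : BX -> R)).
  by apply: (@integrable_bounded _ _ `|m%:R^-1|).
have pointwise (x : BX) : let s := m%:R^-1 * \sum_(i < m) \1_(F i) x in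
    s <= g x <= s + m%:R^-1.
  rewrite /= SE; have /andP[g0 g1] := g01 x.
  have [] := @sum_threshold_bounds (m%:R * g x) m (mulr_ge0 (ltW m0R) g0).
  move=> St _ tS; rewrite -[in X in _ + X](mulr1 m%:R^-1) -mulrDr.
  rewrite !ler_pdivrMl// St ler_pdivlMl//=.
  (* The case left is a full count, where [g x <= 1] bounds [m * g x] by [m]. *)
  case: tS => // tS; apply: (@le_trans _ _ m%:R).
    by rewrite -[leRHS]mulr1 ler_wpM2l ?ler0n.
  by rewrite (le_trans tS)// ler_wpDr.
apply/andP; split.
  by apply: le_Rintegral => // x _; have /andP[] := pointwise x.
rewrite -[X in _ <= _ + X](Rintegral_probability_cst P) -RintegralD//; apply: le_Rintegral => //.
  by have := integrableD measurableT iZ i1; apply: eq_integrable.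
by move=> x _; have /andP[] := pointwise x.
Qed.

Hypothesis cX : compact [set: X].

Lemma continuous_bounded f : continuous f ->
  exists M, 0 < M /\ forall x, `|f x| <= M.
Proof.
move=> cf; have cnf : {within setT, continuous (fun x => `|f x|)}.
  by apply: continuous_subspaceT => x; apply: cvg_norm; exact: cf.
have [c _ fc] := compact_EVT_max (ex_intro _ point I : [set: X] !=set0) cX cnf.
exists (`|f c| + 1); split; first by rewrite ltr_wpDl.
by move=> x; rewrite ler_wpDr// fc// inE.
Qed.

Lemma continuous_integrable P f : continuous f ->
  P.-integrable setT (EFin \o (f : BX -> R)).
Proof.
move=> cf; have [M [_ fM]] := continuous_bounded cf.
by apply: integrable_bounded fM; exact: continuous_borel.
Qed.

Lemma Rintegral_affine P f (a b : R) : continuous f ->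
  \int[P]_x (a * f x + b) = a * \int[P]_x f x + b.
Proof.
move=> cf; have jf := continuous_integrable P cf.
rewrite RintegralD//; last 2 first.
- by have := @integrableZl _ _ _ _ _ measurableT a _ jf; apply: eq_integrable.
- by apply: (@integrable_bounded _ (cst b) `|b|).
by rewrite RintegralZl// Rintegral_probability_cst.
Qed.

End ContinuousIntegrals.

(** * Limits along a free ultrafilter *)

Section FreeUltrafilters.
Context {R : realType}.
Variable w : set_system nat.
Hypothesis hw : free_ultrafilter w.

Lemma free_ultrafilter_proper : ProperFilter w.
Proof.
have [w0 [wT [wI [wS _]]]] := hw.
apply: Build_ProperFilter_ex => [A wA|].
  apply: contrapT => nA; apply: w0; rewrite (_ : set0 = A)//.
  by apply/seteqP; split => // x Ax; apply: nA; exists x.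
by split => // A B AB; exact: wS.
Qed.

Lemma free_ultrafilter_ge k : w [set n | (k <= n)%N].
Proof.
have [_ [_ [_ [_ [wC wfin]]]]] := hw.
have [//|] := wC [set n | (k <= n)%N]; move/wfin => []//.
apply: (@sub_finite_set _ _ `I_k); last exact: finite_II.
by move=> n /= /negP; rewrite -ltnNge.
Qed.

Lemma free_ultrafilter_cvg (u : nat -> R) : (forall n, 0 <= u n <= 1) ->
  cvg (u n @[n --> w]).
Proof.
move=> u01; have Fw := free_ultrafilter_proper.
have [_ [_ [_ [_ [wC _]]]]] := hw.
have U : UltraFilter (u n @[n --> w]).
  apply: Build_UltraFilter => G FG sG; apply/seteqP; split => // A GA.
  have [//|nA] := wC (u @^-1` A).
  have /(filterI GA) : G (~` A) by exact: sG.
  by rewrite setICr => /filter_not_empty.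
have := @segment_compact R 0 1; rewrite compact_ultra => /(_ _ U)[].
  suff w01 : w (u @^-1` `[0, 1]) by exact: w01.
  by apply: filterE => n; rewrite /= in_itv/=; exact: u01.
by move=> l [_ ul]; apply/cvg_ex; exists l.
Qed.

End FreeUltrafilters.

(** * Weak* compactness along the ultrafilter *)

Section WeakStarCompactness.
Context {R : realType} {X : pseudoPMetricType R}.
Local Notation BX := (borelX X).
Hypothesis cX : compact [set: X].
Variable w : set_system nat.
Hypothesis hw : free_ultrafilter w.

(** The limit [L] of the measures along [w] is monotone, subadditive, and additive on disjoint
    closed sets, so [content_extension] yields a probability dominating it on closed sets. *)
Lemma ultralimit_closed_sets (mu : nat -> probability BX R) :
  exists P : probability BX R, forall K, closed K -> forall c,
    w [set n | c <= fine (mu n K)] -> c <= fine (P K).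
Proof.
have Fw := free_ultrafilter_proper hw.
have cv K : closed K -> cvg (fine (mu n K) @[n --> w]).
  move=> cK; apply: free_ultrafilter_cvg => // n; have mK := closed_borel cK.
  by rewrite fine_ge0//= -lee_fin fineK ?fin_num_probability// probability_le1.
pose L (K : set X) : R := lim (fine (mu n K) @[n --> w]).
have [P PL] : exists P : probability BX R, forall K, closed K -> ((L K)%:E <= P K)%E.
  apply: content_extension => //.
  - rewrite /L; under eq_fun do rewrite measure0/=.
    exact: (lim_cst (@Rhausdorff R)).
  - rewrite /L (_ : (fun n => fine (mu n setT)) = cst 1).
      exact: (lim_cst (@Rhausdorff R)).
    by apply/funext => n; rewrite (_ : mu n _ = 1%E)//; exact: probability_setT.
  - move=> K1 K2 cK1 cK2 K12; apply: ler_lim; [exact: cv|exact: cv|].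
    by apply: filterE => n; apply: fine_probability_le => //; exact: closed_borel.
  - move=> K1 K2 cK1 cK2; rewrite /L -limD; [|exact: cv|exact: cv].
    apply: ler_lim; [exact/cv/closedU|by apply: is_cvgD; exact: cv|].
    have mK1 := closed_borel cK1; have mK2 := closed_borel cK2.
    apply: filterE => n.
    suff : fine (mu n (K1 `|` K2)) <= fine (mu n K1) + fine (mu n K2) by [].
    rewrite -fineD ?fin_num_probability//.
    rewrite fine_le ?fin_numD ?fin_num_probability//; first exact: measurableU.
    exact: measureU2.
  - move=> K1 K2 cK1 cK2 K12; rewrite /L -limD; [|exact: cv|exact: cv].
    apply: ler_lim; [by apply: is_cvgD; exact: cv|exact/cv/closedU|].
    have mK1 := closed_borel cK1; have mK2 := closed_borel cK2.
    apply: filterE => n.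
    suff : fine (mu n K1) + fine (mu n K2) <= fine (mu n (K1 `|` K2)) by [].
    rewrite -fineD ?fin_num_probability//.
    by rewrite measureU.
exists P => K cK c wc; rewrite -lee_fin fineK; last first.
  by apply: fin_num_probability; exact: closed_borel.
apply: le_trans (PL K cK); rewrite lee_fin.
by apply: limr_ge => //; exact: cv.
Qed.

(** One direction of the portmanteau theorem: layer sums turn upper bounds on closed sets into upper
    bounds on integrals, and the lower bounds come from [- f]. *)
Lemma closed_sets_weakstar (mu : nat -> probability BX R) (P : probability BX R) :
  (forall K, closed K -> forall c,
    w [set n | c <= fine (mu n K)] -> c <= fine (P K)) ->
  forall f : X -> R, continuous f -> forall e, 0 < e ->
    w [set n | `|\int[mu n]_x f x - \int[P]_x f x| < e].
Proof.
move=> muP; have Fw := free_ultrafilter_proper hw.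
have [_ [_ [_ [_ [wC _]]]]] := hw.
have wlt K c : closed K -> fine (P K) < c -> w [set n | fine (mu n K) < c].
  move=> cK Pc; have [|wge] := wC [set n | fine (mu n K) < c]; first by [].
  have : c <= fine (P K).
    by apply: muP => //; apply: filterS wge => n /negP; rewrite -leNgt.
  by rewrite leNgt Pc.
have unit_upper (g : X -> R) e : continuous g -> (forall x, 0 <= g x <= 1) ->
    0 < e -> w [set n | \int[mu n]_x g x < \int[P]_x g x + e].
  move=> cg g01 e0; have e20 : 0 < e / 2 by rewrite divr_gt0.
  (* Half of [e] pays for the discretisation into [k.+1] layers, the other half for the measures of
     the layers. *)
  have [k _ /(_ k (leqnn k)) /= ke] := near_infty_natSinv_lt (PosNum e20).
  have kpos : 0 < k.+1%:R :> R by rewrite ltr0n.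
  pose F (i : nat) := [set x | i.+1%:R <= k.+1%:R * g x].
  have cF i : closed (F i).
    apply: (@preimage_closed _ _ (fun x => k.+1%:R * g x) [set r | i.+1%:R <= r]).
      by move=> x _; apply: cvgM; [exact: cvg_cst|exact: cg].
    exact: closed_ge.
  have wF : w [set n | forall i : 'I_k.+1, fine (mu n (F i)) < fine (P (F i)) + e / 2].
    apply: (@filter_forall _ _ (fun (i : 'I_k.+1) n =>
      fine (mu n (F i)) < fine (P (F i)) + e / 2)) => i.
    by apply: wlt; rewrite ?ltrDl.
  apply: filterS wF => n /= muF.
  have /andP[_ h1] := Rintegral_layers (mu n) (ltn0Sn k) cg g01.
  have /andP[h2 _] := Rintegral_layers P (ltn0Sn k) cg g01.
  have h3 : k.+1%:R^-1 * (\sum_(i < k.+1) fine (mu n (F i))) <=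
      k.+1%:R^-1 * (\sum_(i < k.+1) fine (P (F i))) + e / 2.
    rewrite -[X in _ + X](mulKf (lt0r_neq0 kpos)) -mulrDr ler_wpM2l ?invr_ge0 ?(ltW kpos)//.
    rewrite [k.+1%:R * _]mulr_natl -[X in _ *+ X]card_ord -sumr_const -big_split/=.
    by apply: ler_sum => i _; exact: ltW.
  move: h1 h2 h3 ke; rewrite -/F.
  set a := _ * _; set b := _ * _; rewrite -/a -/b.
  set r := _^-1; set I1 := Rintegral _ _ _; set I2 := Rintegral _ _ _.
  clearbody a b r I1 I2. lra.
have upper f e : continuous f -> 0 < e ->
    w [set n | \int[mu n]_x f x < \int[P]_x f x + e].
  move=> cf e0; have [M [M0 fM]] := continuous_bounded cX cf.
  (* The affine map [a * t + 1/2] sends the interval from [- M] to [M] onto the unit interval. *)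
  pose a := (2 * M)^-1; have a0 : 0 < a by rewrite invr_gt0 mulr_gt0.
  have aM : a * M = 2^-1 by rewrite /a invfM mulfVK// gt_eqF.
  pose g x := a * f x + 2^-1.
  have cg : continuous g.
    move=> x; apply: cvgD; last exact: cvg_cst.
    by apply: cvgM; [exact: cvg_cst|exact: cf].
  have g01 x : 0 <= g x <= 1.
    have := fM x; rewrite ler_norml => /andP[f1 f2]; rewrite /g -aM.
    have : a * (- M) <= a * f x by rewrite ler_pM2l.
    have : a * f x <= a * M by rewrite ler_pM2l.
    by move: aM; rewrite mulrN => aM h1 h2; apply/andP; split; lra.
  apply: filterS (unit_upper g (a * e) cg g01 (mulr_gt0 a0 e0)) => n /=.
  rewrite /g !(Rintegral_affine cX)// addrAC ltrD2r -mulrDr ltr_pM2l//.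
move=> f cf e e0.
have cNf : continuous (fun x => -1 * f x + 0).
  move=> x; apply: cvgD; last exact: cvg_cst.
  by apply: cvgM; [exact: cvg_cst|exact: cf].
apply: filterS2 (upper f e cf e0) (upper _ e cNf e0) => n /=.
by rewrite !(Rintegral_affine cX)// ltr_norml => h1 h2; apply/andP; split; lra.
Qed.

(* Dini's theorem for the upper semicontinuous functions [mu |-> mu (F k)] on the
   weak* compact set [Delta]. *)
Lemma closed_uniformly_small (Delta : set (probability BX R)) (F : nat -> set X) :
  weakstar_closed Delta -> (forall k, closed (F k)) ->
  (forall j k, (j <= k)%N -> F k `<=` F j) ->
  (forall mu : probability BX R, Delta mu -> mu (\bigcap_k F k) = 0%E) ->
  forall e, 0 < e -> exists k, forall mu : probability BX R, Delta mu ->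
    fine (mu (F k)) < e.
Proof.
move=> clD cF dF F0 e e0; apply: contrapT => /forallNP nk.
have Fw := free_ultrafilter_proper hw.
have /choice[mu muP] : forall k, exists mu : probability BX R,
    Delta mu /\ e <= fine (mu (F k)).
  move=> k; apply: contrapT => /forallNP nmu; apply: (nk k) => mu Dmu.
  by rewrite ltNge; apply/negP => emu; apply: (nmu mu).
have [P PK] := ultralimit_closed_sets mu.
have wsP := closed_sets_weakstar PK.
(* For [n >= k] the set [F k] contains [F n], so it has [mu n]-mass at least [e]; such [n] form a
   set in [w]. *)
have PF k : e <= fine (P (F k)).
  apply: PK => //; apply: filterS (free_ultrafilter_ge hw k) => n /= kn.
  apply: (le_trans (muP n).2); apply: fine_probability_le; [exact: closed_borel..|].
  exact: dF.
(* Otherwise a weak* neighbourhood of [P] misses [Delta], although it contains [mu n] for some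
   [n]. *)
have DP : Delta P.
  apply: contrapT => /clD[k [f [d [d0 [cf fD]]]]].
  have : w [set n | forall i : 'I_k, `|\int[mu n]_x f i x - \int[P]_x f i x| < d].
    by apply: filter_forall => i; exact: wsP.
  move=> /filter_ex[n /= hn]; apply: (fD (mu n)); last exact: (muP n).1.
  move=> i; have fin (Q : probability BX R) : (\int[Q]_x (f i x)%:E \is a fin_num)%E.
    by apply: integrable_fin_num => //; exact: continuous_integrable.
  by rewrite -(fineK (fin (mu n))) -(fineK (fin P)) -EFinB/= lte_fin; exact: hn.
(* Continuity from above forces [P (F k)] to 0, against the lower bound [e]. *)
have cap_cvg : (P \o (F : nat -> set BX)) k @[k --> \oo] --> P (\bigcap_k F k).
  apply: nonincreasing_cvg_mu.
  - by apply: (@le_lt_trans _ _ 1%E); [apply: probability_le1; exact: closed_borel|exact: ltry].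
  - by move=> k; exact: closed_borel.
  - by apply: closed_borel; exact: closed_bigI.
  - by move=> j k jk; apply/subsetPset; exact: dF.
move: cap_cvg; rewrite F0// => /fine_cvg/cvgrPdist_lt/(_ _ e0)[k _ /(_ k (leqnn k))]/=.
by rewrite sub0r normrN ger0_norm ?fine_ge0// ltNge PF.
Qed.

End WeakStarCompactness.

(** * Separation by open sets with null boundary *)

Section SmallBoundaries.
Context {R : realType} {X : pseudoPMetricType R}.
Local Notation BX := (borelX X).
Hypothesis cX : compact [set: X].
Variable Delta : set (probability BX R).
Implicit Types U V K : set X.

Let null_boundary V := open V /\ forall mu : probability BX R, Delta mu ->
  mu ((closure V `\` interior V) : set BX) = 0%E.

Let boundary_borel V : measurable ((closure V `\` interior V) : set BX).
Proof.
apply: measurableD; first by apply: closed_borel; exact: closed_closure.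
by apply: open_borel; exact: open_interior.
Qed.

Let null_boundaryU U V : null_boundary U -> null_boundary V ->
  null_boundary (U `|` V).
Proof.
move=> [oU bU] [oV bV]; split=> [|mu Dmu]; first exact: openU.
apply/eqP; rewrite eq_le measure_ge0 andbT.
apply: (@le_trans _ _ (mu ((closure U `\` interior U) `|` (closure V `\` interior V)))).
  apply: le_measure; rewrite ?inE; [exact: boundary_borel| |].
    by apply: measurableU; exact: boundary_borel.
  move=> x [+ nUV]; rewrite closureU => -[cU|cV]; [left|right]; split => // iW; apply: nUV.
    by apply: interiorS iW => y; left.
  by apply: interiorS iW => y; right.
apply: (@le_trans _ _ (mu (closure U `\` interior U) + mu (closure V `\` interior V))%E).
  by apply: measureU2; exact: boundary_borel.
by rewrite bU// bV// adde0.
Qed.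

(** By compactness, finitely many neighbourhoods with null boundary inside [U] cover [K]; null
    boundaries are stable under finite unions. *)
Lemma small_boundary_separation K U : small_boundary_property Delta ->
  closed K -> open U -> K `<=` U ->
  exists V, [/\ open V, K `<=` V, V `<=` U & forall mu : probability BX R,
    Delta mu -> mu ((closure V `\` V) : set BX) = 0%E].
Proof.
move=> sbp cK oU KU.
have /choice[V HV] : forall x, exists V : set X, K x ->
    [/\ null_boundary V, V x & V `<=` U].
  move=> x; have [Kx|nKx] := pselect (K x); last by exists set0.
  by have [V [oV [Vx [VU bV]]]] := sbp x U oU (KU x Kx); exists V.
have : cover_compact K by rewrite -compact_cover; exact: (subclosed_compact cK cX).
move=> /(_ X K V)[|x Kx|D' DK' KD'].
- by move=> x /HV[[]].
- by exists x => //; have [] := HV x Kx.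
have [D DK KD] : exists2 D : seq X, {subset D <= K} & K `<=` cover [set` D] V.
  by exists (finmap.enum_fset D').
have [oW bW] : null_boundary (cover [set` D] V).
  rewrite /cover bigcup_seq big_seq; apply: (big_ind null_boundary).
  - split; first exact: open0.
    by move=> mu _; rewrite closure0 set0D measure0.
  - by move=> A B; exact: null_boundaryU.
  - by move=> x /DK; rewrite inE => /HV[].
exists (cover [set` D] V); split => //.
- by move=> y [x /= /DK]; rewrite inE => /HV[_ _]; apply.
- by move=> mu Dmu; have := bW mu Dmu; move/interior_id: oW => ->.
Qed.

(* Moving [f] by [e] in opposite directions on the two sides of the null set
   [closure V `\` V] makes [|g| >= e] off a thin neighbourhood of it. *)
Lemma small_boundary_perturbation (w : set_system nat) (f : X -> R) (e d : R) :
  free_ultrafilter w -> weakstar_closed Delta -> small_boundary_property Delta ->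
  continuous f -> 0 < e -> 0 < d ->
  exists g : X -> R, [/\ continuous g, forall x, `|g x - f x| <= 2 * e &
    forall mu : probability BX R, Delta mu -> fine (mu [set x | `|g x| < e]) < d].
Proof.
move=> hw clD sbp cf e0 d0.
have [V [oV KV VU bV]] : exists V, [/\ open V, f @^-1` [set r | r <= - e] `<=` V,
    V `<=` f @^-1` [set r | r < e] & forall mu : probability BX R,
    Delta mu -> mu ((closure V `\` V) : set BX) = 0%E].
  apply: small_boundary_separation => //.
  - by apply: preimage_closed => [x _|]; [exact: cf|exact: closed_le].
  - by apply: open_comp => [x _|]; [exact: cf|exact: open_lt].
  - by move=> x /= fx; apply: (le_lt_trans fx); lra.
have [p [cp p0 pV]] := closed_zero_set (@closed_closure _ V).
have [q [cq q0 qV]] := closed_zero_set (open_closedC oV).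
(* Closed sets decreasing to the common zero set of [p] and [q], which is the boundary of [V]. *)
pose F k := [set x | k.+1%:R * p x <= 1] `&` [set x | k.+1%:R * q x <= 1].
have cZ (u : X -> R) (k : nat) : continuous u -> continuous (fun x => k.+1%:R * u x).
  by move=> cu x; apply: cvgM; [exact: cvg_cst|exact: cu].
have cF k : closed (F k).
  apply: closedI.
    apply: (@preimage_closed _ _ (fun x => k.+1%:R * p x) [set r | r <= 1]).
      by move=> x _; exact: cZ.
    exact: closed_le.
  apply: (@preimage_closed _ _ (fun x => k.+1%:R * q x) [set r | r <= 1]).
    by move=> x _; exact: cZ.
  exact: closed_le.
have dF j k : (j <= k)%N -> F k `<=` F j.
  move=> jk x [/= Fp Fq]; split => /=; [apply: le_trans Fp|apply: le_trans Fq];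
    by rewrite ler_wpM2r// ler_nat ltnS.
have capF : \bigcap_k F k = closure V `\` V.
  have zero (u : X -> R) x : 0 <= u x -> (forall k, k.+1%:R * u x <= 1) -> u x = 0.
    move=> u0 uk; apply/eqP; rewrite eq_le u0 andbT leNgt; apply/negP => ux.
    have [k _ /(_ k (leqnn k)) /= ke] := near_infty_natSinv_lt (PosNum ux).
    by have := uk k; rewrite leNgt -ltr_pdivrMl ?ltr0n// mulr1 ke.
  apply/seteqP; split => [x Fx|x [cVx nVx] k _].
    split; first by apply/pV/zero => // k; have [] := Fx k I.
    suff : (~` V) x by [].
    by apply/qV/zero => // k; have [] := Fx k I.
  have px : p x = 0 by apply/pV.
  have qx : q x = 0 by apply/qV.
  by split; rewrite /= ?px ?qx mulr0.
have [k muF] : exists k, forall mu : probability BX R, Delta mu -> fine (mu (F k)) < d.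
  by apply: (closed_uniformly_small cX hw clD cF dF) => // mu Dmu; rewrite capF bV.
(* Outside [F k], [h] is -1 on [V] and 1 off [V]. Since [f < e] on [V] and [f > - e] off [V], a
   shift by [2 * e] carries the values past [- e] and [e] respectively. *)
pose h := ((fun x => k.+1%:R * p x) \min cst 1) \- ((fun x => k.+1%:R * q x) \min cst 1).
pose g x := f x + 2 * e * h x.
have ch : continuous h.
  move=> x; apply: continuousB.
    by apply: continuous_min; [exact: cZ|exact: cvg_cst].
  by apply: continuous_min; [exact: cZ|exact: cvg_cst].
have cg : continuous g.
  move=> x; apply: cvgD; first exact: cf.
  by apply: cvgM; [exact: cvg_cst|exact: ch].
have clamp (r : R) : 0 <= r -> 0 <= Num.min r 1 <= 1.
  by move=> r0; rewrite le_min r0 ler01 ge_min lexx orbT.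
have p01 x := clamp _ (mulr_ge0 (ler0n R k.+1) (p0 x)).
have q01 x := clamp _ (mulr_ge0 (ler0n R k.+1) (q0 x)).
exists g; split => //.
  move=> x; rewrite /g addrC addKr normrM ger0_norm ?mulr_ge0 ?(ltW e0)//.
  rewrite -[leRHS]mulr1 ler_wpM2l ?mulr_ge0 ?(ltW e0)//.
  have /andP[p1 p2] := p01 x; have /andP[q1 q2] := q01 x.
  by rewrite /h/= ler_norml; apply/andP; split; lra.
move=> mu Dmu; apply: le_lt_trans (muF mu Dmu).
apply: fine_probability_le; [|exact: closed_borel|].
  apply: open_borel; apply: (@open_comp _ _ (fun x => `|g x|) [set r | r < e]).
    by move=> x _; apply: cvg_norm; exact: cg.
  exact: open_lt.
move=> x /=; rewrite ltr_norml => /andP[g1 g2].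
have /andP[p1 p2] := p01 x; have /andP[q1 q2] := q01 x.
have [Vx|nVx] := pselect (V x).
- have fx : f x < e := VU x Vx.
  have px : p x = 0 by apply/pV/subset_closure.
  split; rewrite /= ?px ?mulr0// leNgt; apply/negP => q3.
  have hx : h x = -1 by rewrite /h/= px mulr0 min_l// sub0r min_r// ltW.
  by move: g1; rewrite /g hx; lra.
- have fx : - e < f x by rewrite ltNge; apply/negP => /KV.
  have qx : q x = 0 by apply/qV.
  split; rewrite /= ?qx ?mulr0// leNgt; apply/negP => p3.
  have hx : h x = 1 by rewrite /h/= qx mulr0 [X in _ - X]min_l// subr0 min_r// ltW.
  by move: g2; rewrite /g hx; lra.
Qed.

End SmallBoundaries.

(** * Estimates for the complex modulus *)

Section ComplexNorm.
Context {R : realType}.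
Local Notation C := R[i].
Local Notation normc := ComplexField.Normc.normc.
Implicit Types z : C.

Lemma normc_ge0 z : 0 <= normc z.
Proof. by case: z => a b; exact: sqrtr_ge0. Qed.

Lemma normc_sqr z : normc z ^+ 2 = complex.Re z ^+ 2 + complex.Im z ^+ 2.
Proof. by case: z => a b /=; rewrite sqr_sqrtr// addr_ge0 ?sqr_ge0. Qed.

Lemma normc_le_sqr z (r : R) : 0 <= r ->
  (normc z <= r) = (complex.Re z ^+ 2 + complex.Im z ^+ 2 <= r ^+ 2).
Proof. by move=> r0; rewrite -normc_sqr ler_sqr ?nnegrE ?normc_ge0. Qed.

Lemma Re_le_normc z : `|complex.Re z| <= normc z.
Proof.
by rewrite -ler_sqr ?nnegrE ?normc_ge0// normc_sqr real_normK ?num_real// lerDl sqr_ge0.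
Qed.

Lemma Im_le_normc z : `|complex.Im z| <= normc z.
Proof.
by rewrite -ler_sqr ?nnegrE ?normc_ge0// normc_sqr real_normK ?num_real// lerDr sqr_ge0.
Qed.

Lemma normc_le_ReIm z : normc z <= `|complex.Re z| + `|complex.Im z|.
Proof.
rewrite normc_le_sqr ?addr_ge0// sqrrD !real_normK ?num_real//.
by rewrite -addrA lerD2l ler_wpDl// mulrn_wge0// mulr_ge0.
Qed.

Lemma normc_real (r : R) : normc (Complex r 0) = `|r|.
Proof. by rewrite /= expr0n/= addr0 sqrtr_sqr. Qed.

End ComplexNorm.

(** * Bounded sequences of functions and the trace-kernel ideal *)

Section SequenceAlgebra.
Context {R : realType} {X : pseudoPMetricType R}.
Local Notation BX := (borelX X).
Local Notation C := R[i].
Local Notation normc := ComplexField.Normc.normc.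
Hypothesis cX : compact [set: X].
Variable w : set_system nat.
Hypothesis hw : free_ultrafilter w.
Variable Delta : set (probability BX R).
Implicit Types (a b : nat -> X -> C) (f g : nat -> X -> R).

Definition real_seq f : nat -> X -> C := fun n x => Complex (f n x) 0.

Lemma normc_sqr_continuous (u : X -> C) : ccontinuous u ->
  continuous (fun x => normc (u x) ^+ 2).
Proof.
move=> [cre cim]; under eq_fun do rewrite normc_sqr.
by move=> x; apply: cvgD; apply: cvgM; [exact: cre|exact: cre|exact: cim|exact: cim].
Qed.

(** The integrands are continuous on a compact space, so the integrals are finite and the extended
    supremum can be traded for a uniform real bound. *)
Lemma J2P a : J2 w Delta a <-> linf a /\ forall e, 0 < e ->
  w [set n | forall mu : probability BX R, Delta mu ->
    \int[mu]_x (normc (a n x) ^+ 2) < e].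
Proof.
have Fw := free_ultrafilter_proper hw.
split=> -[la Ja]; split => // e e0; have int (mu : probability BX R) n :
    (\int[mu]_x (normc (a n x) ^+ 2)%:E)%E = (\int[mu]_x (normc (a n x) ^+ 2))%:E.
- rewrite fineK//; apply: integrable_fin_num => //.
  by apply: continuous_integrable => //; apply: normc_sqr_continuous; exact: la.1.
- apply: filterS (Ja e e0) => n /= sup mu Dmu; rewrite -lte_fin -int.
  by apply: le_lt_trans sup; apply: ereal_sup_ubound; exists mu.
- rewrite fineK//; apply: integrable_fin_num => //.
  by apply: continuous_integrable => //; apply: normc_sqr_continuous; exact: la.1.
(* A supremum of values below [e / 2] may equal [e / 2]; halving restores the strict inequality. *)
- have e20 : 0 < e / 2 by rewrite divr_gt0.
  apply: filterS (Ja _ e20) => n /= sup.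
  apply: (@le_lt_trans _ _ (e / 2)%:E); last by rewrite lte_fin; lra.
  by apply: ge_ereal_sup => _ [mu Dmu <-]; rewrite int lee_fin ltW// sup.
Qed.

Lemma J2_dominated a b : J2 w Delta a -> linf b ->
  (forall n x, normc (b n x) <= normc (a n x)) -> J2 w Delta b.
Proof.
have Fw := free_ultrafilter_proper hw.
move=> /J2P[la Ja] lb ba; apply/J2P; split => // e e0.
apply: filterS (Ja e e0) => n /= sup mu Dmu; apply: le_lt_trans (sup mu Dmu).
apply: le_Rintegral => //.
- by apply: continuous_integrable => //; apply: normc_sqr_continuous; exact: lb.1.
- by apply: continuous_integrable => //; apply: normc_sqr_continuous; exact: la.1.
- by move=> x _; rewrite ler_sqr ?nnegrE ?normc_ge0.
Qed.

Lemma real_seq_linf f M : (forall n, continuous (f n)) ->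
  (forall n x, `|f n x| <= M) -> linf (real_seq f).
Proof.
move=> cf fM; split.
  by move=> n; split; [exact: cf|exact: cst_continuous].
by exists M => n x; rewrite normc_real.
Qed.

Lemma linf_bound a : linf a -> exists M, 0 < M /\ forall n x, normc (a n x) <= M.
Proof.
move=> [_ [M aM]]; exists (`|M| + 1); split; first by rewrite ltr_wpDl.
by move=> n x; apply: (le_trans (aM n x)); rewrite ler_wpDr// ler_norm.
Qed.

Lemma J2_0 : J2 w Delta (real_seq (fun _ _ => 0)).
Proof.
have Fw := free_ultrafilter_proper hw.
apply/J2P; split.
  by apply: (@real_seq_linf _ 0) => [n|n x]; [exact: cst_continuous|rewrite normr0].
move=> e e0; apply: filterE => n mu _.
under eq_Rintegral do rewrite normc_real normr0 expr0n/=.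
by rewrite Rintegral_cst// mul0r.
Qed.

Lemma real_seq_selfadjoint f : linf (real_seq f) ->
  quot_selfadjoint w Delta (real_seq f).
Proof.
move=> lf; split => //; rewrite (_ : Defs.seq_sub _ _ = real_seq (fun _ _ => 0)).
  exact: J2_0.
apply/funext => n; apply/funext => x; rewrite /Defs.seq_sub /seq_conj /real_seq/=.
by apply/eqP; rewrite eq_complex/= subrr subr0 oppr0 !eqxx.
Qed.

End SequenceAlgebra.

(** * Invertibility in the quotient and functions that rarely come near zero *)

Section RealRankZero.
Context {R : realType} {X : pseudoPMetricType R}.
Local Notation BX := (borelX X).
Local Notation C := R[i].
Local Notation normc := ComplexField.Normc.normc.
Hypothesis cX : compact [set: X].
Variable w : set_system nat.
Hypothesis hw : free_ultrafilter w.
Variable Delta : set (probability BX R).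
Implicit Types (f g c : X -> R).

(** [c] is [1 / t] where [|t| >= e] and [t / e ^+ 2] elsewhere, hence depends continuously on [t];
    the product [t * c] stays between 0 and 1. *)
Lemma truncated_inverse (e t : R) : 0 < e ->
  let c := t * (Num.max (t ^+ 2) (e ^+ 2))^-1 in
  [/\ `|c| <= e^-1, (t * c - 1) ^+ 2 <= 1 & e <= `|t| -> t * c = 1].
Proof.
move=> e0 c; have e2 : 0 < e ^+ 2 by rewrite exprn_gt0.
have m0 : 0 < Num.max (t ^+ 2) (e ^+ 2) by rewrite lt_max e2 orbT.
have tc : t * c = t ^+ 2 / Num.max (t ^+ 2) (e ^+ 2) by rewrite /c mulrA.
have tc0 : 0 <= t * c by rewrite tc divr_ge0 ?sqr_ge0// ltW.
have tc1 : t * c <= 1 by rewrite tc ler_pdivrMr// mul1r le_max lexx.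
split.
- rewrite /c normrM normfV [`|Num.max _ _|]ger0_norm ?(ltW m0)//.
  rewrite ler_pdivrMr// ler_pdivlMl//.
  have [et|te] := leP e `|t|.
    rewrite le_max -real_normK ?num_real// expr2 ler_wpM2r//.
  by rewrite le_max expr2 ler_wpM2l ?orbT// ltW.
- rewrite -[leRHS](expr1n R 2) -ler_sqrt ?sqr_ge0// expr1n sqrtr1 sqrtr_sqr.
  by rewrite ler_norml; apply/andP; split; lra.
- move=> et; rewrite tc max_l ?divff//.
    by rewrite sqrf_eq0 -normr_gt0 (lt_le_trans e0).
  by rewrite -[leRHS]real_normK ?num_real// ler_sqr ?nnegrE ?(ltW e0).
Qed.

Lemma truncated_inverse_continuous (e : R) g : 0 < e -> continuous g ->
  continuous (fun x => g x * (Num.max (g x ^+ 2) (e ^+ 2))^-1).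
Proof.
move=> e0 cg x; apply: cvgM; first exact: cg.
have m0 : Num.max (g x ^+ 2) (e ^+ 2) != 0.
  by rewrite gt_eqF// lt_max (exprn_gt0 2 e0) orbT.
apply: (cvgV m0); have := @continuous_max R X (fun x => g x ^+ 2) (cst (e ^+ 2)) x.
apply; last exact: cvg_cst.
by apply: cvgM; exact: cg.
Qed.

(** The real part of the term [a n] is perturbed with tolerance [1 / n.+1] on measures. The
    truncated inverses then invert the result modulo the ideal, because the products differ from 1
    only on sets of vanishing measure. *)
Lemma sbp_real_rank_zero : weakstar_closed Delta ->
  small_boundary_property Delta -> quot_real_rank_zero w Delta.
Proof.
move=> clD sbp a [la sa] e e0; have Fw := free_ultrafilter_proper hw.
(* The perturbation lemma moves by twice its parameter, which makes [e / 2 < e] here. *)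
have e40 : 0 < e / 4 by rewrite divr_gt0.
have [M [M0 aM]] := linf_bound la.
have /choice[g Hg] : forall n, exists g : X -> R,
    [/\ continuous g, forall x, `|g x - complex.Re (a n x)| <= 2 * (e / 4) &
    forall mu : probability BX R, Delta mu ->
      fine (mu [set x | `|g x| < e / 4]) < n.+1%:R^-1].
  move=> n; apply: (small_boundary_perturbation cX hw) => //.
    exact: (la.1 n).1.
have cg n : continuous (g n) by have [] := Hg n.
have gf n x : `|g n x - complex.Re (a n x)| <= 2 * (e / 4) by have [_ + _] := Hg n.
pose c n x := g n x * (Num.max (g n x ^+ 2) ((e / 4) ^+ 2))^-1.
have cc n : continuous (c n) by exact: truncated_inverse_continuous.
have lg : linf (real_seq g).
  apply: (@real_seq_linf _ _ _ (2 * (e / 4) + M)) => // n x.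
  rewrite -[g n x](subrK (complex.Re (a n x))); apply: (le_trans (ler_normD _ _)).
  by apply: lerD => //; exact: (le_trans (Re_le_normc _) (aM n x)).
have lc : linf (real_seq c).
  apply: (@real_seq_linf _ _ _ (e / 4)^-1) => // n x.
  by have [] := truncated_inverse (g n x) e40.
have gc_sqr n x : normc (Complex (g n x) 0 * Complex (c n x) 0 - 1) ^+ 2 =
    (g n x * c n x - 1) ^+ 2.
  by rewrite normc_sqr/= !mulr0 mul0r !subr0 addr0 expr0n/= addr0.
have Jgc : J2 w Delta (Defs.seq_sub (seq_mul (real_seq g) (real_seq c)) seq_one).
  apply/(J2P cX hw); split.
    rewrite (_ : Defs.seq_sub _ _ = real_seq (fun n x => g n x * c n x - 1)).
      apply: (@real_seq_linf _ _ _ 1) => [n|n x].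
        by move=> x; apply: cvgB; [apply: cvgM; [exact: cg|exact: cc]|exact: cvg_cst].
      have [_ h _] := truncated_inverse (g n x) e40.
      by rewrite -ler_sqr ?nnegrE// real_normK ?num_real// expr1n.
    apply/funext => n; apply/funext => x; apply/eqP.
    rewrite eq_complex /Defs.seq_sub /seq_mul /real_seq /seq_one/=.
    by rewrite !mulr0 !mul0r !subr0 addr0 !eqxx.
  move=> d d0; have [k _ kd] := near_infty_natSinv_lt (PosNum d0).
  apply: filterS (free_ultrafilter_ge hw k) => n /= kn mu Dmu.
  rewrite /Defs.seq_sub /seq_mul /real_seq /seq_one.
  under eq_Rintegral do rewrite gc_sqr.
  pose A : set BX := [set x | `|g n x| < e / 4].
  have mA : measurable A.
    apply: open_borel; apply: (@open_comp _ _ (fun x => `|g n x|) [set r | r < e / 4]).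
      by move=> x _; apply: cvg_norm; exact: cg.
    exact: open_lt.
  have [_ _ /(_ mu Dmu) muA] := Hg n.
  (* The squared error is at most 1 on [A] and 0 off it, so its integral is at most the measure of
     [A]. *)
  apply: le_lt_trans (lt_trans muA (kd n kn)).
  rewrite -[X in fine (mu X)]setIT -(integral_indic mu measurableT mA).
  apply: le_Rintegral => //.
  - apply: continuous_integrable => // x.
    by apply: cvgM; (apply: cvgB; [apply: cvgM; [exact: cg|exact: cc]|exact: cvg_cst]).
  - exact: indic_integrable.
  - move=> x _; have [_ h1 h2] := truncated_inverse (g n x) e40.
    rewrite indicE; case: (boolP (x \in A)) => [_//|]; rewrite notin_setE /A/= => /negP.
    by rewrite -leNgt => /h2; rewrite -/(c n x) => ->; rewrite subrr expr0n.
exists (real_seq g); split; first exact: real_seq_selfadjoint.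
split.
  have Jcg : J2 w Delta (Defs.seq_sub (seq_mul (real_seq c) (real_seq g)) seq_one).
    rewrite (_ : seq_mul _ _ = seq_mul (real_seq g) (real_seq c))//.
    by apply/funext => n; apply/funext => x; rewrite /seq_mul mulrC.
  exact: (conj lg (ex_intro _ (real_seq c) (conj lc (conj Jgc Jcg)))).
(* The imaginary part of [a] lies in the ideal, being dominated by the difference of [a] and its
   conjugate; removing it leaves a real error of at most [e / 2]. *)
exists (fun n x => Complex 0 (complex.Im (a n x))); split.
  apply: (J2_dominated cX hw sa).
    split.
      by move=> n; split; [exact: cst_continuous|exact: (la.1 n).2].
    exists M => n x; rewrite (le_trans _ (aM n x))// normc_le_sqr ?normc_ge0//.
    by rewrite normc_sqr expr0n/= lerD2r sqr_ge0.
  move=> n x; rewrite normc_le_sqr ?normc_ge0// normc_sqr /Defs.seq_sub /seq_conj.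
  case: (a n x) => r s /=; rewrite subrr -opprD sqrrN expr0n/= !add0r.
  by have := sqr_ge0 s; rewrite !expr2; lra.
exists (e / 2); split; first lra.
move=> n x; have := gf n x; rewrite /real_seq.
rewrite (_ : a n x - _ - _ = Complex (complex.Re (a n x) - g n x) 0); last first.
  by case: (a n x) => r s; apply/eqP; rewrite eq_complex/= !subr0 subrr !eqxx.
rewrite normc_real distrC.
by move/le_trans; apply; lra.
Qed.

(** The point [p + q] lies between [t - e] and [t + e], and the clamped [p] is the nearest point to
    [p] in that interval, so it is at distance at most [|q|]. *)
Lemma clamp_dist (t p q s e r : R) : r < e -> `|q| <= s -> `|t - p - q| <= r ->
  `|p - Num.max (t - e) (Num.min (t + e) p)| <= s.
Proof.
rewrite !ler_norml => re /andP[h1 h2] /andP[h3 h4].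
have [h5|h5] := leP (t + e) p.
  by have [h6|h6] := leP (t - e) (t + e); apply/andP; split; lra.
by have [h6|h6] := leP (t - e) p; apply/andP; split; lra.
Qed.

(** The sum [p + q + s] is at least 1/2 and Cauchy-Schwarz contributes a factor 3, whence 12 = 3 *
    4. *)
Lemma sum_sqr_ge1 (p q s : R) : 1 <= p + (2^-1 + q + s) ->
  1 <= 12 * (p ^+ 2 + q ^+ 2 + s ^+ 2).
Proof.
move=> h; have := sqr_ge0 (p - q); have := sqr_ge0 (p - s); have := sqr_ge0 (q - s).
by have := sqr_ge0 (2 * (p + q + s) - 1); rewrite !expr2; lra.
Qed.

(** Take an invertible self-adjoint class near [f], with representative [b] and inverse [c] bounded
    by [M]. Where the perturbed function is small, one of [b c - 1], the ideal part [j] of the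
    distance, and the imaginary part of [b] must be large; Markov's inequality bounds the measure of
    that set. *)
Lemma real_rank_zero_perturbation f (e d : R) : quot_real_rank_zero w Delta ->
  continuous f -> 0 < e -> 0 < d ->
  exists (g : X -> R) (h : R), [/\ continuous g, 0 < h, forall x, `|g x - f x| <= e &
    forall mu : probability BX R, Delta mu -> fine (mu [set x | `|g x| <= h]) < d].
Proof.
move=> rr cf e0 d0; have Fw := free_ultrafilter_proper hw.
have [B [B0 fB]] := continuous_bounded cX cf.
have saf : quot_selfadjoint w Delta (real_seq (fun _ => f)).
  by apply: (real_seq_selfadjoint cX hw); exact: (@real_seq_linf _ _ _ B).
have [b [[lb sb] [[_ [c [lc [Jbc _]]]] [j [Jj [r [re bj]]]]]]] := rr _ saf e e0.
have [M [M0 cM]] := linf_bound lc.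
(* Chosen so that the final bound [12 * (d' + M ^+ 2 * d' + M ^+ 2 * d')] equals [d]. *)
pose d' := d / (12 * (1 + 2 * M ^+ 2)).
have D0 : 0 < 12 * (1 + 2 * M ^+ 2) by rewrite mulr_gt0// ltr_wpDr// mulr_ge0// sqr_ge0.
have d'0 : 0 < d' by rewrite divr_gt0.
have [lbc /(_ _ d'0) w1] := (J2P cX hw _ _).1 Jbc.
have [lj /(_ _ d'0) w2] := (J2P cX hw _ _).1 Jj.
have [ls /(_ _ d'0) w3] := (J2P cX hw _ _).1 sb.
(* A single index at which all three errors are small already provides the perturbation. *)
have [n [[s1 s2] s3]] := filter_ex (filterI (filterI w1 w2) w3).
pose u1 := Defs.seq_sub (seq_mul b c) seq_one n.
pose u3 := Defs.seq_sub (seq_conj b) b n.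
have c1 := normc_sqr_continuous (lbc.1 n); rewrite -/u1 in c1.
have c2 := normc_sqr_continuous (lj.1 n).
have c3 := normc_sqr_continuous (ls.1 n); rewrite -/u3 in c3.
(* The quotient norm bounds [f - b] only up to [j], so the real part of [b n] is clamped to within
   [e] of [f]; by [clamp_dist] this changes it by at most the modulus of [j]. *)
pose g x := Num.max (f x - e) (Num.min (f x + e) (complex.Re (b n x))).
have cg : continuous g.
  move=> x; apply: (@continuous_max R X (fun x => f x - e)).
    by apply: cvgB; [exact: cf|exact: cvg_cst].
  apply: (@continuous_min R X (fun x => f x + e)); last exact: (lb.1 n).1.
  by apply: cvgD; [exact: cf|exact: cvg_cst].
have gf x : `|g x - f x| <= e.
  rewrite /g ler_norml; apply/andP; split.
    by rewrite lerBrDr addrC le_max lexx.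
  by rewrite lerBlDr ge_max ge_min; apply/andP; split; [lra|rewrite addrC lexx].
have gb x : `|complex.Re (b n x) - g x| <= normc (j n x).
  have := Re_le_normc (real_seq (fun _ => f) n x - b n x - j n x).
  have -> : complex.Re (real_seq (fun _ => f) n x - b n x - j n x) =
      f x - complex.Re (b n x) - complex.Re (j n x).
    by rewrite /real_seq; case: (b n x) => b1 b2; case: (j n x) => j1 j2.
  by move=> /le_trans/(_ (bj n x)); exact: clamp_dist re (Re_le_normc _).
have Imb x : `|complex.Im (b n x)| <= normc (u3 x).
  apply: le_trans (Im_le_normc _); rewrite /u3 /Defs.seq_sub /seq_conj.
  case: (b n x) => b1 b2/=; rewrite -opprD normrN -mulr2n normrMn.
  by rewrite mulr2n lerDl.
(* With [M * h] equal to 1/2, the value of [g] on [A] accounts for at most half of the product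
   [b c]. *)
pose h := (2 * M)^-1; have h0 : 0 < h by rewrite invr_gt0 mulr_gt0.
have hM : M * h = 2^-1 by rewrite /h invfM mulrCA divff ?mulr1// gt_eqF.
exists g, h; split => // mu Dmu.
pose A : set BX := [set x | `|g x| <= h].
have mA : measurable A.
  apply: closed_borel; apply: (@preimage_closed _ _ (fun x => `|g x|) [set r | r <= h]).
    by move=> x _; apply: cvg_norm; exact: cg.
  exact: closed_le.
pose G x := normc (u1 x) ^+ 2 + M ^+ 2 * normc (j n x) ^+ 2 + M ^+ 2 * normc (u3 x) ^+ 2.
have iZ (k : X -> R) : continuous k -> continuous (fun x => M ^+ 2 * k x).
  by move=> ck x; apply: cvgM; [exact: cvg_cst|exact: ck].
have c12 : continuous (fun x => normc (u1 x) ^+ 2 + M ^+ 2 * normc (j n x) ^+ 2).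
  by move=> x; apply: cvgD; [exact: c1|exact: iZ].
have cG : continuous G.
  by move=> x; apply: cvgD; [exact: c12|exact: iZ].
have pointwise x : \1_A x <= 12 * G x.
  rewrite indicE; have [|] := boolP (x \in A); last first.
    move=> _; apply: mulr_ge0 => //; rewrite /G.
    by apply: addr_ge0; [apply: addr_ge0; [exact: sqr_ge0|]|];
      apply: mulr_ge0; exact: sqr_ge0.
  rewrite inE /A/= => gx.
  (* Write 1 as [b c - u1] and bound the modulus of [b] by [|g|], the clamping error and the
     imaginary part. *)
  have h1 : 1 <= normc (u1 x) + M * (h + normc (j n x) + normc (u3 x)).
    have -> : 1 = normc (- u1 x + b n x * c n x).
      by rewrite /u1 /Defs.seq_sub /seq_mul /seq_one opprB subrK ComplexField.Normc.normc1.
    apply: (le_trans (le_normcD _ _)); rewrite normcN lerD2l ComplexField.Normc.normcM mulrC.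
    apply: ler_pM => //; rewrite ?normc_ge0//.
    apply: (le_trans (normc_le_ReIm _)); rewrite lerD//.
    by rewrite -[complex.Re _](subrK (g x)) addrC (le_trans (ler_normD _ _))// lerD.
  move: h1; rewrite [M * _]mulrDr [M * (h + _)]mulrDr hM /G => h1.
  by rewrite -2!exprMn; exact: sum_sqr_ge1.
have i1 := continuous_integrable cX mu c1.
have i12 := continuous_integrable cX mu c12.
rewrite -[X in fine (mu X)]setIT -(integral_indic mu measurableT mA).
apply: (@le_lt_trans _ _ (12 * \int[mu]_x G x)).
  have cG12 : continuous (fun x => 12 * G x).
    by move=> x; apply: cvgM; [exact: cvg_cst|exact: cG].
  rewrite -RintegralZl//; last exact: continuous_integrable.
  apply: le_Rintegral => //; first exact: indic_integrable.
  exact: continuous_integrable.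
rewrite /G RintegralD//; last exact/continuous_integrable/iZ.
rewrite RintegralD//; last exact/continuous_integrable/iZ.
rewrite !RintegralZl//; [|exact: continuous_integrable..].
have M2 : 0 < M ^+ 2 by rewrite exprn_gt0.
have <- : 12 * (d' + M ^+ 2 * d' + M ^+ 2 * d') = d.
  have : d' * (12 * (1 + 2 * M ^+ 2)) = d by rewrite /d' mulfVK// gt_eqF.
  by move=> <-; lra.
rewrite ltr_pM2l//.
by rewrite !ltrD ?ltr_pM2l//; [exact: s1|exact: s2|exact: s3].
Qed.

End RealRankZero.

(** * Null boundaries from iterated perturbations *)

Section SmallBoundaryFromRealRankZero.
Context {R : realType} {X : pseudoPMetricType R}.
Local Notation BX := (borelX X).
Hypothesis cX : compact [set: X].
Variable w : set_system nat.
Hypothesis hw : free_ultrafilter w.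
Variable Delta : set (probability BX R).

(** Each move is bounded by the drop of the threshold, so by telescoping all moves after stage [k]
    add up to less than [h k]: a value beyond a threshold stays beyond all later ones. *)
Lemma nested_perturbations (f0 : X -> R) (h0 : R) : quot_real_rank_zero w Delta ->
  continuous f0 -> 0 < h0 ->
  exists (f : nat -> X -> R) (h : nat -> R), [/\ f 0%N = f0 /\ h 0%N = h0,
    forall k, continuous (f k), forall k, 0 < h k,
    forall k x, `|f k.+1 x - f k x| <= h k - h k.+1 &
    forall k (mu : probability BX R), Delta mu ->
      fine (mu [set x | `|f k.+1 x| <= h k.+1]) < k.+1%:R^-1].
Proof.
move=> rr cf0 h00; pose good (s : (X -> R) * R) := continuous s.1 /\ 0 < s.2.
pose next k (s s' : (X -> R) * R) := [/\ good s',
  forall x, `|s'.1 x - s.1 x| <= s.2 - s'.2 &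
  forall mu : probability BX R, Delta mu ->
    fine (mu [set x | `|s'.1 x| <= s'.2]) < k.+1%:R^-1].
(* Dependent choice: a successor is chosen for every pair of a stage and a state, with an arbitrary
   value at bad states, and then iterated. *)
have /choice[F HF] : forall ks : nat * ((X -> R) * R), exists s',
    good ks.2 -> next ks.1 ks.2 s'.
  move=> [k [f h]]; have [[/= cf h1]|?] := pselect (good (f, h)); last by exists (f, h).
  have h2 : 0 < h / 2 by rewrite divr_gt0.
  have k0 : 0 < k.+1%:R^-1 :> R by rewrite invr_gt0 ltr0n.
  have [g [d [cg d0 gf gmu]]] := real_rank_zero_perturbation cX hw rr cf h2 k0.
  (* A threshold of at most [d] keeps the measure bound; one of at most [h / 2] leaves a drop of at
     least [h / 2] to cover the move from [f] to [g]. *)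
  exists (g, Num.min d (h / 2)) => _; split; first by split => //=; rewrite lt_min d0.
    move=> x /=; apply: (le_trans (gf x)).
    have : Num.min d (h / 2) <= h / 2 by rewrite ge_min lexx orbT.
    lra.
  move=> mu Dmu /=; apply: le_lt_trans (gmu mu Dmu).
  have cl (r : R) : closed [set x | `|g x| <= r].
    apply: (@preimage_closed _ _ (fun x => `|g x|) [set t | t <= r]); last exact: closed_le.
    by move=> x _; apply: cvg_norm; exact: cg.
  apply: fine_probability_le; [exact: (closed_borel (cl _))..|].
  by move=> x /=; rewrite le_min => /andP[].
pose s k := iteri k (fun k s => F (k, s)) (f0, h0).
have gs k : good (s k).
  by elim: k => [//|k ih]; have [] := HF (k, s k) ih.
exists (fun k => (s k).1), (fun k => (s k).2); split => //.
- by move=> k; have [] := gs k.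
- by move=> k; have [] := gs k.
- by move=> k x; have [_ + _] := HF (k, s k) (gs k); exact.
- by move=> k mu Dmu; have [_ _] := HF (k, s k) (gs k); exact.
Qed.

(* [V] collects the points at which some [f k] is below [- h k]; any later [f j]
   stays below [- h j] there, so [V] is disjoint from its mirror image [W] and
   its boundary lies in every [{|f k| <= h k}]. *)
Lemma real_rank_zero_sbp : quot_real_rank_zero w Delta ->
  small_boundary_property Delta.
Proof.
move=> rr x U oU Ux.
have [p [cp p0 pU]] := closed_zero_set (open_closedC oU).
have px : 0 < p x by rewrite lt_neqAle p0 andbT eq_sym; apply/eqP => /pU.
(* [f0] is -1 at [x] and 1 off [U]; with threshold 1/2 this puts [x] in [V] and the complement of
   [U] in [W]. *)
pose f0 y := 1 - 2 * (p x)^-1 * p y.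
have cf0 : continuous f0.
  move=> y; apply: cvgB; first exact: cvg_cst.
  by apply: cvgM; [exact: cvg_cst|exact: cp].
have h00 : 0 < 2^-1 :> R by [].
have [f [h [[f0E h0E] cf h_gt0 fh fmu]]] := nested_perturbations rr cf0 h00.
pose V := \bigcup_k [set y | f k y < - h k].
pose W := \bigcup_k [set y | h k < f k y].
have Vup j k y : (j <= k)%N -> f j y < - h j -> f k y < - h k.
  move=> /subnK <-; elim: (k - j)%N => [//|i ih] /ih.
  have := fh (i + j)%N y; rewrite ler_norml addSn => /andP[_ h2]; lra.
have Wup j k y : (j <= k)%N -> h j < f j y -> h k < f k y.
  move=> /subnK <-; elim: (k - j)%N => [//|i ih] /ih.
  have := fh (i + j)%N y; rewrite ler_norml addSn => /andP[h1 _]; lra.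
have VW y : V y -> ~ W y.
  move=> [j _ /= fj] [k _ /= fk].
  have := Vup _ _ _ (leq_maxl j k) fj; have := Wup _ _ _ (leq_maxr j k) fk.
  have := h_gt0 (maxn j k); lra.
have oV : open V.
  apply: bigcup_open => k _; apply: (@open_comp _ _ (f k) [set r | r < - h k]).
    by move=> y _; exact: cf.
  exact: open_lt.
have oW : open W.
  apply: bigcup_open => k _; apply: (@open_comp _ _ (f k) [set r | h k < r]).
    by move=> y _; exact: cf.
  exact: open_gt.
exists V; split => //; split; [|split].
- by exists 0%N => //=; rewrite f0E h0E /f0 mulrVK ?unitfE ?gt_eqF//; lra.
- move=> y Vy; apply: contrapT => nUy; apply: VW Vy _.
  by exists 0%N => //=; rewrite f0E h0E /f0 ((pU y).2 nUy); lra.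
move=> mu Dmu; have bV k : closure V `\` interior V `<=` [set y | `|f k y| <= h k].
  move=> y [cVy]; rewrite (interior_id V).1// => nVy /=.
  rewrite ler_norml; apply/andP; split; rewrite leNgt; apply/negP => fy.
    by apply: nVy; exists k.
  (* A boundary point with [f k y > h k] lies in the open set [W], which would then meet [V]. *)
  have [z [Vz Wz]] : V `&` W !=set0.
    by apply: cVy; apply: open_nbhs_nbhs; split => //; exists k.
  exact: VW Vz Wz.
have mbV : measurable ((closure V `\` interior V) : set BX).
  apply: measurableD; first by apply: closed_borel; exact: closed_closure.
  by apply: open_borel; exact: open_interior.
apply/eqP; rewrite -[mu _]fineK ?fin_num_probability// eqe eq_le fine_ge0// andbT.
rewrite leNgt; apply/negP => mu0.
(* The bound [1 / k.+1] belongs to stage [k.+1], since nothing is known about the measures at stage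
   0. *)
have [k _ /(_ k (leqnn k)) /= kmu] := near_infty_natSinv_lt (PosNum mu0).
have := lt_trans (fmu k mu Dmu) kmu; apply/negP; rewrite -leNgt.
apply: fine_probability_le => //; apply: closed_borel.
apply: (@preimage_closed _ _ (fun y => `|f k.+1 y|) [set t | t <= h k.+1]); last exact: closed_le.
by move=> y _; apply: cvg_norm; exact: cf.
Qed.

End SmallBoundaryFromRealRankZero.

Theorem theorem2p12 (R : realType) (X : pseudoPMetricType R)
    (hX : hausdorff_space X) (cX : compact [set: X])
    (w : set (set nat)) (hw : free_ultrafilter w)
    (Delta : set (probability (borelX X) R)) (hD : weakstar_closed Delta) :
  quot_real_rank_zero w Delta <-> small_boundary_property Delta.
Proof.
split; first exact: real_rank_zero_sbp.
exact: sbp_real_rank_zero.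
Qed.
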